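(* Let $m_1,m_2,m_3,m_4$ be positive integers. There exist nonzero $A,B,C\in\mathbb{C}$ with $B/A\notin\mathbb{R}$ such that $BC(B-C)=m_2m_3$, $CA(C-A)=m_1m_4$, and $AB(A-B)=m_1m_2$. *)

(* Defs.v *)
From HB Require Import structures.
From mathcomp Require Export all_boot all_order all_algebra.
From mathcomp Require Export reals complex.
Set Implicit Arguments.
Unset Strict Implicit.
Unset Printing Implicit Defensive.

(* Main.v *)
(** Put [u = (B - C) / A], [v = (C - A) / B], [w = (A - B) / C]; these satisfy
    [u + v + w + u v w = 0], and the three products are [ABC u], [ABC v],
    [ABC w].  Asking for [(u, v, w) = t (p, q, r)] with [p, q, r > 0] forces
    [t^2 = - (p + q + r) / (p q r) < 0], so [t] is not real.  The system
    [B - C = t p A], [C - A = t q B], [A - B = t r C] is then singular, which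
    determines [B / A = - p (1 - t r) / (q + r)] (not real, as [t] is not) and
    [C / A]; the scale [A] is a cube root chosen so that [ABC t = 1]. *)
Require Import Defs.
From mathcomp Require Import all_boot all_order all_algebra.
From mathcomp Require Import reals complex ring.
Import Order.TTheory GRing.Theory Num.Theory.
Local Open Scope ring_scope.
Local Open Scope complex_scope.

Lemma sqr_lt0_nreal (K : numDomainType) (t : K) :
  t ^+ 2 < 0 -> t \isn't Num.real.
Proof.
move=> t2lt0; apply/negP => treal.
by move: t2lt0; rewrite le_gtF // real_exprn_even_ge0.
Qed.

(** In [K], [0 < p] also makes [p] real, which is what the nonreality of [t] and [b] rests on. *)
Lemma cyclic_products_solvable (K : numClosedFieldType) (p q r : K) :
  0 < p -> 0 < q -> 0 < r ->
  exists A B C : K,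
    [/\ A != 0, B != 0 & C != 0] /\
    B / A \isn't Num.real /\
    [/\ B * C * (B - C) = p, C * A * (C - A) = q & A * B * (A - B) = r].
Proof.
move=> p0 q0 r0; have qr0 := addr_gt0 q0 r0.
have pn0 := lt0r_neq0 p0; have qn0 := lt0r_neq0 q0.
have rn0 := lt0r_neq0 r0; have qrn0 := lt0r_neq0 qr0.
pose t : K := sqrtC (- ((p + (q + r)) / (p * q * r))).
have t2 : t ^+ 2 = - ((p + (q + r)) / (p * q * r)) by rewrite sqrtCK.
have tnreal : t \isn't Num.real.
  by apply: sqr_lt0_nreal; rewrite t2 oppr_lt0 divr_gt0 ?addr_gt0 ?mulr_gt0.
have p_real := gtr0_real p0; have q_real := gtr0_real q0.
have r_real := gtr0_real r0.
(* [b] and [c] are the ratios [B / A] and [C / A], kept opaque behind [bE] and [cE]. *)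
have [b bE] : exists b : K, b = - p * (1 - t * r) / (q + r) by eexists.
have [c cE] : exists c : K, c = - p * (1 + t * q) / (q + r) by eexists.
have bnreal : b \isn't Num.real.
  apply: contra tnreal => b_real.
  (* [bE] is affine in [t] with real coefficients, so it can be solved for [t]. *)
  suff -> : t = (1 + b * (q + r) / p) / r.
    by rewrite !(rpredM, rpredD, rpredV, rpred1).
  by rewrite bE; field; rewrite pn0 qrn0 rn0.
have tn0 : t != 0 by apply: contraNneq tnreal => ->; rewrite real0.
have bn0 : b != 0 by apply: contraNneq bnreal => ->; rewrite real0.
have cn0 : c != 0.
  rewrite cE !mulf_neq0 ?oppr_eq0 ?invr_eq0 //.
  apply: contraNneq tnreal => tq.
  suff -> : t = - q^-1 by rewrite realN realV.
  apply: (mulIf qn0); rewrite mulNr mulVf //.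
  by apply/eqP; rewrite -addr_eq0 addrC tq.
have bc : b - c = t * p by rewrite bE cE; field.
have ca : c - 1 = t * q * b.
  (* Isolates [t ^+ 2]: the equation holds only for the value given by [t2]. *)
  have -> : t * q * b = (- (t * q * p) + t ^+ 2 * (p * q * r)) / (q + r).
    by rewrite bE; field.
  by rewrite t2 cE; field; rewrite pn0 qn0 rn0 qrn0.
have ab : 1 - b = t * r * c.
  have -> : t * r * c = - (t * r * p + t ^+ 2 * (p * q * r)) / (q + r).
    by rewrite cE; field.
  by rewrite t2 bE; field; rewrite pn0 qn0 rn0 qrn0.
pose A : K := 3.-root (b * c * t)^-1.
have A3 : A ^+ 3 = (b * c * t)^-1 by rewrite rootCK.
have An0 : A != 0.
  by rewrite rootC_eq0 // invr_eq0 !mulf_neq0.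
(* Each of the three products takes this form, with [x] equal to [p], [q] or [r]. *)
have scale x : b * c * t * x * A ^+ 3 = x.
  by rewrite A3; field; rewrite tn0 cn0 bn0.
exists A, (b * A), (c * A); split; first by rewrite !mulf_neq0.
split; first by rewrite mulfK.
split.
- have -> : b * A * (c * A) * (b * A - c * A) = b * c * (b - c) * A ^+ 3 by ring.
  by rewrite bc -[RHS]scale; ring.
- have -> : c * A * A * (c * A - A) = c * (c - 1) * A ^+ 3 by ring.
  by rewrite ca -[RHS]scale; ring.
- have -> : A * (b * A) * (A - b * A) = b * (1 - b) * A ^+ 3 by ring.
  by rewrite ab -[RHS]scale; ring.
Qed.

Theorem lemma4p2 (R : realType) (m1 m2 m3 m4 : nat)
    (hm1 : (0 < m1)%N) (hm2 : (0 < m2)%N) (hm3 : (0 < m3)%N) (hm4 : (0 < m4)%N) :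
  exists A B C : R[i],
    [/\ A != 0, B != 0 & C != 0] /\
    ~ (exists r : R, B / A = r%:C) /\
    [/\ B * C * (B - C) = (m2 * m3)%:R,
        C * A * (C - A) = (m1 * m4)%:R
      & A * B * (A - B) = (m1 * m2)%:R].
Proof.
have pos m n : (0 < m)%N -> (0 < n)%N -> 0 < (m * n)%:R :> R[i].
  by move=> m0 n0; rewrite ltr0n muln_gt0 m0.
have [A [B [C [neq0 [nreal eqs]]]]] := cyclic_products_solvable
  _ _ _ _ (pos _ _ hm2 hm3) (pos _ _ hm1 hm4) (pos _ _ hm1 hm2).
exists A, B, C; split=> //; split=> //.
by move/complex_realP; apply/negP.
Qed.
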